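(* Let $l\ge 3$ be an integer, and let $n$ and $N$ be positive integers. Suppose that each of the numbers $1,2,\ldots,N$ has one of $n$ colours assigned to it, and that there are no monochromatic solutions to the equation $$x_1+x_2+\cdots+x_l=y.$$ Then $N\le e\,(n\lceil\log_2 l\rceil)!$.
   Context: A monochromatic solution of an equation, with respect to a colouring of $\{1,\ldots,N\}$, is an assignment of values in $\{1,\ldots,N\}$, all of the same colour, to the variables such that the equation holds; the values of the variables need not be distinct. Here $e$ is the base of the natural logarithm. *)

(* Defs.v *)
From mathcomp Require Import all_boot all_order all_algebra.
From mathcomp Require Import reals sequences exp.
Set Implicit Arguments.
Unset Strict Implicit.
Unset Printing Implicit Defensive.
Import Order.TTheory GRing.Theory Num.Theory.

(* A colouring of {1, ..., N} is represented by a function on all of nat, of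
   which only the values at 1, ..., N are ever used. *)
Definition monochromatic_solution (n N l : nat) (c : nat -> 'I_n)
    (x : 'I_l -> nat) (y : nat) : Prop :=
  [/\ forall i : 'I_l, 1 <= x i <= N,
      1 <= y <= N,
      forall i : 'I_l, c (x i) = c y
    & \sum_(i < l) x i = y].

(* Num.ceil is int-valued; the absolute value only serves to land in nat, as
   the ceiling is nonnegative for l >= 1. *)
Definition ceil_log2 (R : realType) (l : nat) : nat :=
  absz (Num.ceil (ln l%:R / ln 2%:R : R)%R).

(* Main.v *)
Require Import Defs.
From mathcomp Require Import all_boot all_order all_algebra.
From mathcomp Require Import reals sequences exp.
From mathcomp Require Import zify.
Set Implicit Arguments.
Unset Strict Implicit.
Unset Printing Implicit Defensive.
Import Order.TTheory GRing.Theory Num.Theory.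

(** Join [i < j] in [{0, ..., N}] by an edge of colour [c (j - i)], and let [V]
    be a set of vertices spanning edges of only [m] colours, with least
    element [v].  For each colour [a], let [B] be the set of [a]-neighbours of
    [v] in [V].  A monotone [a]-coloured path with [l] vertices in [B] would
    exhibit the difference between its last vertex and [v] as a sum of [l]
    numbers of colour [a], and this difference itself has colour [a].  Hence
    [B] splits into [l - 1] sets without edges of colour [a] (by length of
    longest path), so that the maximal size [g m] of [V] satisfies
    [g m <= 1 + m * (l - 1) * g (m - 1)].  As [l <= 2 ^ k] for
    [k = ceil (log2 l)], this yields [N < g n <= 2 * (n * k)!]. *)

Fixpoint walk_ends (T : finType) (e : rel T) (B : {set T}) (t : nat) : {set T} :=
  if t is t'.+1 then [set x in B | [exists y in walk_ends e B t', e y x]] else B.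

Lemma walk_ends_sub (T : finType) (e : rel T) (B : {set T}) (t : nat) :
  walk_ends e B t \subset B.
Proof. by case: t => [|t] //=; apply/subsetP => x; rewrite inE => /andP[]. Qed.

Lemma card_walk_ends (T : finType) (e : rel T) (B : {set T}) (g t : nat) :
    (forall D : {set T}, D \subset B ->
       (forall x y, x \in D -> y \in D -> ~~ e x y) -> #|D| <= g) ->
  #|B| <= #|walk_ends e B t| + t * g.
Proof.
move=> indep; elim: t => [|t IH] /=; first by rewrite mul0n addn0.
set L := walk_ends e B t in IH *; set L' := [set x in B | _].
have LB : L \subset B by exact: walk_ends_sub.
have DL : #|L :\: L'| <= g.
  apply: indep; first by apply: subset_trans LB; apply: subsetDl.
  move=> x y /setDP[xL _] /setDP[yL yL']; apply: contra yL' => exy.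
  by rewrite inE (subsetP LB) //=; apply/existsP; exists x; rewrite xL.
have := cardsID L' L; have := subset_leq_card (subsetIr L L').
by rewrite mulSn; lia.
Qed.

Fixpoint clique_bound (s m : nat) : nat :=
  if m is p.+1 then (p.+1 * (s * clique_bound s p)).+1 else 1.

Section DifferenceColouring.

Variables (n N l : nat) (c : nat -> 'I_n).

Let diff_edge (a : 'I_n) : rel 'I_N.+1 := fun i j => (i < j) && (c (j - i) == a).

Lemma walk_ends_sum (a : 'I_n) (B : {set 'I_N.+1}) (t : nat) (x : 'I_N.+1) :
    x \in walk_ends (diff_edge a) B t ->
  exists2 y : 'I_N.+1, y \in B & exists2 s : seq nat,
    size s = t & all (fun d => (0 < d) && (c d == a)) s /\ x = y + sumn s :> nat.
Proof.
elim: t x => [|t IH] x /=; first by exists x => //; exists [::]; rewrite ?addn0.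
rewrite inE => /andP[_ /existsP[z /andP[/IH[y yB [s ss [sa zE]]] /andP[zx cz]]]].
exists y => //; exists ((x - z) :: s); rewrite /= ?ss // subn_gt0 zx cz sa.
by split=> //; lia.
Qed.

Hypothesis l_gt0 : 0 < l.
Hypothesis no_sum : forall (a : 'I_n) (s : seq nat), size s = l ->
  all (fun d => (0 < d) && (c d == a)) s -> c (sumn s) = a -> N < sumn s.

Lemma card_clique (V : {set 'I_N.+1}) (C : {set 'I_n}) :
    (forall x y, x \in V -> y \in V -> x < y -> c (y - x) \in C) ->
  #|V| <= clique_bound l.-1 #|C|.
Proof.
move Em: #|C| => m; elim: m => [|m IH] in C V Em * => VC.
  move/eqP: Em; rewrite cards_eq0 => /eqP C0; rewrite /= leqNgt.
  apply/negP => /card_gt1P[x [y [xV yV]]]; rewrite neq_ltn => xy.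
  by case/orP: xy => [/(VC _ _ xV yV)|/(VC _ _ yV xV)]; rewrite C0 inE.
have [->|[v0 v0V]] := set_0Vmem V; first by rewrite cards0.
pose v := [arg min_(i < v0 | i \in V) (i : nat)].
have [vV vmin] : v \in V /\ forall x : 'I_N.+1, x \in V -> v <= x.
  by rewrite /v; case: arg_minnP.
rewrite (cardsD1 v) vV add1n ltnS.
have VvC x : x \in V :\ v -> (v < x) && (c (x - v) \in C).
  case/setD1P => xv xV.
  by have vx : v < x by [rewrite ltn_neqAle eq_sym xv vmin]; rewrite vx VC.
rewrite -sum1_card (partition_big (fun x : 'I_N.+1 => c (x - v)) (mem C)) /=; last first.
  by move=> x /VvC/andP[].
rewrite -Em -sum_nat_const; apply: leq_sum => a aC; rewrite sum1dep_card.
set B := [set x | _].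
suff E0 : walk_ends (diff_edge a) B l.-1 = set0.
  have := @card_walk_ends _ (diff_edge a) B (clique_bound l.-1 m) l.-1.
  rewrite E0 cards0 add0n; apply=> D DB Dindep; apply: (IH (C :\ a)).
    by have := cardsD1 a C; rewrite aC Em add1n => -[].
  have DV z : z \in D -> z \in V.
    by move=> /(subsetP DB); rewrite inE => /andP[/setD1P[]].
  move=> x y xD yD xy; rewrite in_setD1 VC ?DV // andbT.
  by have := Dindep x y xD yD; rewrite /diff_edge xy.
apply/setP => x; rewrite inE; apply/negP => xE.
have := subsetP (walk_ends_sub _ _ _) _ xE; rewrite inE => /andP[/VvC/andP[vx _] /eqP cx].
have [y + [s ss [sa xy]]] := walk_ends_sum xE.
rewrite inE => /andP[/VvC/andP[vy _] cy].
have sum_xv : sumn ((y - v) :: s) = x - v by rewrite /=; lia.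
have := @no_sum a ((y - v) :: s); rewrite sum_xv /= ss prednK // subn_gt0 vy cy sa.
by move=> /(_ erefl isT cx); have := ltn_ord x; lia.
Qed.

End DifferenceColouring.

Lemma leq_fact_expn_fact (m j : nat) : m`! * m.+1 ^ j <= (m + j)`!.
Proof.
elim: j => [|j IH]; first by rewrite expn0 muln1 addn0.
by rewrite addnS factS expnS mulnCA leq_mul // ltnS leq_addr.
Qed.

Lemma clique_bound_fact (k s m : nat) :
  1 < k -> s < 2 ^ k -> clique_bound s m <= 2 * (m * k)`!.
Proof.
case: k => [|[|k]] // _ sk; elim: m => [|[|m] IH] //.
  rewrite /= mul1n muln1 mul1n; apply: leq_trans sk _.
  have := leq_fact_expn_fact 1 k.+1; rewrite add1n mul1n.
  by rewrite (expnS 2 k.+1) leq_mul2l.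
set p := m.+1 in IH *.
suff step : p.+1 * 2 ^ k.+2 * (p * k.+2)`! <= (p.+1 * k.+2)`!.
  rewrite (_ : clique_bound s p.+1 = (p.+1 * (s * clique_bound s p)).+1) //.
  move: (clique_bound s p) (fact_gt0 (p * k.+2)) IH => g f0 IH.
  have sg : (s * g).+1 <= 2 ^ k.+2 * (2 * (p * k.+2)`!).
    apply: (@leq_trans (s.+1 * (2 * (p * k.+2)`!))); last by rewrite leq_mul2r sk orbT.
    rewrite mulSn; apply: (@leq_add 1); first by rewrite muln_gt0.
    by rewrite leq_mul2l IH orbT.
  apply: (@leq_trans (p.+1 * (s * g).+1)); first by rewrite mulnS; lia.
  apply: leq_trans (leq_mul (leqnn p.+1) sg) _.
  by rewrite mulnA (mulnCA (p.+1 * _) 2) leq_mul2l.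
have -> : p.+1 * k.+2 = (p * k.+2 + k.+1).+1 by lia.
rewrite factS -mulnA.
have -> : (p * k.+2 + k.+1).+1 = p.+1 * k.+2 by lia.
rewrite -(mulnA p.+1) leq_mul2l /=.
apply: leq_trans (leq_mul (leqnn k.+2) (leq_fact_expn_fact (p * k.+2) k.+1)).
rewrite (expnS 2 k.+1) -mulnA; apply: leq_mul => //.
by rewrite mulnC leq_mul2l leq_exp2r // ltnS muln_gt0 orbT.
Qed.

Lemma leq_expn_ceil_log2 (R : realType) (l : nat) : 0 < l -> l <= 2 ^ ceil_log2 R l.
Proof.
move=> l0; rewrite -(ler_nat R) natrX.
have l0R : (0 < l%:R :> R)%R by rewrite ltr0n.
have ln2 : (0 < ln 2%:R :> R)%R by rewrite ln_gt0 ?ltr1n.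
rewrite -ler_ln ?posrE ?exprn_gt0 // lnXn // -[X in (_ <= X)%R]mulr_natl -ler_pdivrMr //.
apply: le_trans (ceil_ge _) _.
by rewrite natr_absz ler_int ler_norm.
Qed.

Theorem theorem6 (R : realType) (l n N : nat) (hl : 3 <= l) (hn : 0 < n)
    (hN : 0 < N) (c : nat -> 'I_n)
    (hc : ~ exists (x : 'I_l -> nat) (y : nat),
        monochromatic_solution N c x y) :
  (N%:R <= expR 1 * ((n * ceil_log2 R l)`!)%:R :> R)%R.
Proof.
have l0 : 0 < l by lia.
have lk := @leq_expn_ceil_log2 R l l0.
set k := ceil_log2 R l in lk *.
have k1 : 1 < k by move: lk; case: k => [|[|k]] //; lia.
have no_sum (a : 'I_n) (s : seq nat) : size s = l ->
    all (fun d => (0 < d) && (c d == a)) s -> c (sumn s) = a -> N < sumn s.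
  move=> sl /allP sa ca; rewrite ltnNge; apply/negP => sN; apply: hc.
  exists (fun i : 'I_l => nth 0 s i), (sumn s).
  have sE : \sum_(i < l) nth 0 s i = sumn s by rewrite sumnE (big_nth 0) sl big_mkord.
  have mem (i : 'I_l) : nth 0 s i \in s by rewrite mem_nth ?sl.
  have le (i : 'I_l) : nth 0 s i <= sumn s by rewrite -sE (bigD1 i) //= leq_addr.
  have pos (i : 'I_l) : 0 < nth 0 s i by have /andP[] := sa _ (mem i).
  split=> //.
  - by move=> i; rewrite pos (leq_trans (le i)).
  - by rewrite sN andbT (leq_trans (pos (Ordinal l0))).
  - by move=> i; have /andP[_ /eqP ->] := sa _ (mem i).
have := @card_clique n N l c l0 no_sum setT setT (fun _ _ _ _ _ => in_setT _).
rewrite !cardsT !card_ord => Nb.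
have Nk : N <= 2 * (n * k)`!.
  apply: leq_trans (ltnW Nb) _; apply: clique_bound_fact => //.
  by rewrite prednK.
have e2 : (2%:R <= expR 1 :> R)%R.
  by have := expR_ge1Dx (1 : R)%R; rewrite -[(1 + 1)%R]/(2%:R)%R.
apply: (@le_trans _ _ ((2 * (n * k)`!)%:R)%R); first by rewrite ler_nat.
by rewrite natrM ler_wpM2r.
Qed.
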